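(* Let $I$ be a finite set, and let $S\subseteq\mathbb Z^I$ be a local good semigroup with maximal ideal $M_S$. The following are equivalent. (a) Every good semigroup $S'$ with $S\subseteq S'\subseteq\overline S$ is symmetric. (b) $S$ and $M_S-M_S$ are symmetric good semigroups. (c) There is an $n\in2\mathbb N$ such that $S=\langle2,n+1\rangle$ (with $|I|=1$), or there is an $n\in2\mathbb N+1$ such that $$S=\langle\mathbf 1\rangle\cup\left(\left(\tfrac{n+1}{2}\right)_{i\in I}+\mathbb N^I\right),$$ where $|I|=2$.
   Context: $\mathbb N$ contains $0$. For a finite set $I$, $\mathbb Z^I$ carries the componentwise partial order; $\mathbf 0=(0,\dots,0)$, $\mathbf 1=(1,\dots,1)$. $\langle\cdots\rangle$ denotes the submonoid generated. For $E,F\subseteq\mathbb Z^I$ put $E-F=\{\alpha\in\mathbb Z^I\mid\alpha+F\subseteq E\}$. Properties of $E\subseteq\mathbb Z^I$: (E0) there is $\alpha\in\mathbb Z^I$ with $\alpha+\mathbb N^I\subseteq E$; (E1) if $\alpha,\beta\in E$, then the componentwise minimum $\inf(\alpha,\beta)\in E$; (E2) for $\alpha,\beta\in E$ with $\alpha_j=\beta_j$ for some $j\in I$ there is $\varepsilon\in E$ with $\varepsilon_j>\alpha_j=\beta_j$ and $\varepsilon_i\ge\min\{\alpha_i,\beta_i\}$ for all $i\in I$, with equality whenever $\alpha_i\ne\beta_i$. A good semigroup is a submonoid $S$ of $\mathbb Z^I$ with all elements $\ge\mathbf 0$ satisfying (E0), (E1), (E2); put $\overline S=\{\alpha\in\mathbb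 Z^I\mid\alpha\ge\mathbf 0\}=\mathbb N^I$. A good semigroup ideal of $S$ is a non-empty $E\subseteq\mathbb Z^I$ with $E+S\subseteq E$, $\alpha+E\subseteq S$ for some $\alpha\in S$, satisfying (E1) and (E2). A good semigroup ideal $M\subsetneq S$ is maximal if $E=M$ for every good semigroup ideal $E$ of $S$ with $M\subseteq E\subsetneq S$. $S$ is local if it has a unique maximal ideal $M_S$; equivalently, $\mathbf 0$ is the only element of $S$ with a zero component, and then $M_S=S\setminus\{\mathbf 0\}$. The conductor of $S$ is $\gamma_S=\inf\{\alpha\in\mathbb Z^I\mid\alpha+\overline S\subseteq S\}$, and $\tau_S=\gamma_S-\mathbf 1$. For $\alpha\in\mathbb Z^I$ let $\Delta_i(\alpha)=\{\beta\in\mathbb Z^I\mid\beta_i=\alpha_i,\ \beta_j>\alpha_j\text{ for all }j\ne i\}$, $\Delta(\alpha)=\bigcup_{i\in I}\Delta_i(\alpha)$, $\Delta^S(\alpha)=\Delta(\alpha)\cap S$. A good semigroup $S$ is symmetric if $S=\{\alpha\in\mathbb Z^I\mid\Delta^S(\tau_S-\alpha)=\emptyset\}$. *)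

(* Defs.v *)
From mathcomp Require Import all_boot all_order all_algebra.
From mathcomp Require Import boolp classical_sets functions.
Set Implicit Arguments.
Unset Strict Implicit.
Unset Printing Implicit Defensive.
Import Order.TTheory GRing.Theory Num.Theory.
Local Open Scope classical_set_scope.
Local Open Scope ring_scope.

(* Z^I is I -> int, with the pointwise group and ring structure from functions
   (so 0 and 1 are the constant vectors) and the pointwise lattice order from
   boolp, written with the %O delimiter. *)

Section GoodSemigroups.
Variable I : finType.
Implicit Types (E F M S : set (I -> int)) (a b e : I -> int).

Definition Sbar : set (I -> int) := [set a : I -> int | ((0 : I -> int) <= a)%O].

Definition translate a E : set (I -> int) := [set a + b | b in E].

Definition colon E F : set (I -> int) := [set a : I -> int | translate a F `<=` E].

Definition submonoid S : Prop :=
  S 0 /\ forall a b, S a -> S b -> S (a + b).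

Definition generated E : set (I -> int) := smallest submonoid E.

Definition E0 E : Prop := exists a, translate a Sbar `<=` E.

Definition E1 E : Prop := forall a b, E a -> E b -> E (Order.meet a b).

Definition E2 E : Prop :=
  forall a b (j : I), E a -> E b -> a j = b j ->
    exists e, [/\ E e, a j < e j
      & forall i, Num.min (a i) (b i) <= e i
               /\ (a i <> b i -> e i = Num.min (a i) (b i))].

Definition good_semigroup S : Prop :=
  [/\ submonoid S, S `<=` Sbar, E0 S, E1 S & E2 S].

Definition good_ideal S E : Prop :=
  [/\ E !=set0,
      forall a b, E a -> S b -> E (a + b),
      exists2 a, S a & translate a E `<=` S,
      E1 E & E2 E].

Definition maximal_ideal S M : Prop :=
  [/\ good_ideal S M, M `<` S
    & forall E, good_ideal S E -> M `<=` E -> E `<` S -> E = M].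

Definition local_semigroup S : Prop := exists! M, maximal_ideal S M.

(* The default value 0 is never used when S is a good semigroup: the set is then
   nonempty, bounded below, and hence has an infimum in Z^I. *)
Definition conductor S : I -> int :=
  infimum (0 : I -> int) [set a : I -> int | translate a Sbar `<=` S].

Definition tau S : I -> int := conductor S - 1.

Definition Delta_at (i : I) a : set (I -> int) :=
  [set b : I -> int | b i = a i /\ forall j, j != i -> a j < b j].

Definition Delta a : set (I -> int) := \bigcup_(i in [set: I]) Delta_at i a.

Definition DeltaS S a : set (I -> int) := Delta a `&` S.

Definition symmetric_semigroup S : Prop :=
  good_semigroup S /\ S = [set a : I -> int | DeltaS S (tau S - a) = set0].

End GoodSemigroups.

Arguments Sbar {I}.

(* Main.v *)
Require Import Defs.
From mathcomp Require Import all_boot all_order all_algebra.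
From mathcomp Require Import boolp classical_sets functions.
From mathcomp Require Import zify.
Set Implicit Arguments.
Unset Strict Implicit.
Unset Printing Implicit Defensive.
Import Order.TTheory GRing.Theory Num.Theory.
Local Open Scope classical_set_scope.
Local Open Scope ring_scope.

(** Locality forces M to be S without 0, and makes every element of M positive
    in each coordinate (local_maximal_ideal). Write T for M - M, tau for tau S.

    (a) -> (b). Symmetry of S says that S is dual to itself under
    E |-> { a | Delta^E(tau - a) is empty }, and this map computes S - E for
    every E stable under S. Hence T is the set of nonnegative a with
    Delta^M(tau - a) empty (end_max_idealP). From this description T is S
    together with Delta(tau) as soon as tau >= 0, and a point of T whose j-th
    coordinate is at least tau_j may be raised there without leaving T. The
    latter supplies (E2) at j when the common j-th coordinate is at least tau_j;
    below tau_j the points of T are in S, which has (E2). So T is a good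
    semigroup between S and N^I (end_max_ideal_good).

    (b) -> (c). Dualizing T with respect to S gives back M, that is
    M = { a | Delta^T(tau - a) is empty }. Symmetry of T makes the same
    condition say that a - d lies in T, where d = tau S - tau T. Thus M = d + T
    (max_ideal_translate), and as T is the union of S and Delta(tau), descent
    gives
      S = N d u U_(k >= 1) (k d + Delta(tau))       (both_symmetric_cases).
    The right-hand side is thin, yet S contains all of gamma + N^I. Looking at
    points of gamma + N^I that are minimal in some coordinates, one finds d = 2
    if I has one element; otherwise d = 1 everywhere and I cannot have three
    elements. In both cases the displayed union is the semigroup in (c). The
    argument needs tau >= 0; if this fails then gamma vanishes and S = N.

    (c) -> (a). A good semigroup between S and N^I has the shape of S again: if
    |I| = 1 it is <2, m> for its least odd element m, and if |I| = 2 it is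
    <1> u ((m, m) + N^2) for the least such m, because a point (p, q) with p < q
    spreads, by (E2) and (E1), to all of (p, p) + N^2. Symmetry of these
    semigroups is read off from their conductors. *)

(** * Coordinates *)

Section Coordinates.
Variable I : finType.
Implicit Types (E S : set (I -> int)) (a b c : I -> int) (i j : I).

Lemma zerofE i : (0 : I -> int) i = 0. Proof. by []. Qed.
Lemma addfE a b i : (a + b) i = a i + b i. Proof. by []. Qed.
Lemma oppfE a i : (- a) i = - a i. Proof. by []. Qed.
Definition coordE := (addfE, oppfE, zerofE).

Lemma translateE a E b : translate a E b = E (b - a).
Proof.
apply: propext; split=> [[c Ec <-]|Eba]; first by rewrite addrC addKr.
by exists (b - a); rewrite // addrC subrK.
Qed.

Lemma SbarP a : Sbar a <-> forall i, 0 <= a i.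
Proof. by split=> /lefP. Qed.

Lemma translate_Sbar_subP a S :
  translate a Sbar `<=` S <-> forall b, (forall i, a i <= b i) -> S b.
Proof.
split=> [aS b le_ab|aS b].
  apply: aS; rewrite translateE; apply/SbarP => i.
  by have := le_ab i; rewrite !coordE; lia.
rewrite translateE => /SbarP ab; apply: aS => i.
by have := ab i; rewrite !coordE; lia.
Qed.

Lemma DeltaS0P S a :
  DeltaS S a = set0 <->
  forall i b, S b -> b i = a i -> ~ (forall j, j != i -> a j < b j).
Proof.
split=> [D0 i b Sb bi bj|D0].
  suff: DeltaS S a b by rewrite D0.
  by split=> //; exists i.
by apply/seteqP; split=> // b [[i _ [bi bj]] Sb]; apply: (D0 i b).
Qed.

Lemma meet_coord a b i : Order.meet a b i = Num.min (a i) (b i).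
Proof. by rewrite meetfE meetEtotal. Qed.

End Coordinates.

(** * The conductor *)

Section Conductor.
Variable I : finType.
Implicit Types (S : set (I -> int)) (a b c : I -> int) (i j : I).

Lemma tauE S i : tau S i = conductor S i - 1. Proof. by []. Qed.

Lemma conductor_unique S c :
  (forall b, (forall i, c i <= b i) -> S b) ->
  (forall a, (forall b, (forall i, a i <= b i) -> S b) ->
    forall i, c i <= a i) ->
  conductor S = c.
Proof.
move=> cS c_least; rewrite /conductor /infimum.
set C := [set a | _].
have Cc : C c by apply/translate_Sbar_subP.
have lbc : lbound C c.
  by move=> a /translate_Sbar_subP aS; apply/lefP; apply: c_least.
rewrite ifF; last by apply/negbTE/set0P; exists c.
case: xgetP => [x _ [lbx ubx]|/(_ c)[]]; last by split=> // b; apply.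
by apply/le_anti/andP; split; [exact: lbx|exact: ubx].
Qed.

(** The corners c with c + N^I inside S are closed under infimum by (E1), so a
    corner of least coordinate sum is the least corner; hence the infimum that
    defines the conductor is attained. *)
Lemma conductorP S : good_semigroup S ->
  (forall b, (forall i, conductor S i <= b i) -> S b) /\
  (forall i, 0 <= conductor S i).
Proof.
move=> [_ Spos [a0 /translate_Sbar_subP a0S] S1 _].
pose C a := forall b, (forall i, a i <= b i) -> S b.
have Cpos a i : C a -> 0 <= a i.
  by move=> Ca; move: i; apply/SbarP/Spos/Ca.
pose size_C n := `[< exists a, C a /\ \sum_i a i = n%:Z >].
have exC : exists n, size_C n.
  exists (absz (\sum_i a0 i)); apply/asboolP; exists a0; split=> //.
  by rewrite gez0_abs // sumr_ge0 // => i _; apply: Cpos.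
case: (ex_minnP exC) => n /asboolP[c [Cc sum_c]] min_n.
have Cmeet a b : C a -> C b -> C (Order.meet a b).
  move=> Ca Cb x le_x.
  (* x is the infimum of its joins with a and with b *)
  have -> : x = Order.meet (fun i => Num.max (a i) (x i))
                           (fun i => Num.max (b i) (x i)).
    apply/funext => i; rewrite meet_coord.
    by have := le_x i; rewrite meet_coord; lia.
  by apply: S1; [apply: Ca|apply: Cb] => i; lia.
have c_least a : C a -> forall i, c i <= a i.
  move=> Ca i; rewrite leNgt; apply/negP => lt_ac.
  have Cm := Cmeet _ _ Cc Ca.
  have sum_m : \sum_i Order.meet c a i < n%:Z.
    rewrite -sum_c [ltLHS](bigD1 i) // [ltRHS](bigD1 i) //= meet_coord.
    apply: ltr_leD; first by lia.
    by apply: ler_sum => j _; rewrite meet_coord; lia.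
  have sum_ge0 : 0 <= \sum_i Order.meet c a i.
    by apply: sumr_ge0 => j _; apply: Cpos.
  have := min_n (absz (\sum_i Order.meet c a i)).
  have -> : size_C (absz (\sum_i Order.meet c a i)).
    by apply/asboolP; exists (Order.meet c a); rewrite gez0_abs.
  by move/(_ isT); lia.
have -> : conductor S = c by apply: conductor_unique.
by split=> // i; apply: Cpos.
Qed.

End Conductor.

(** * Local good semigroups *)

Section Locality.
Variable I : finType.
Implicit Types (S M E : set (I -> int)) (a b c : I -> int) (i j : I).

(** Maximality rests on (E2): a larger ideal has an element vanishing at i, and
    comparing it with 0 produces a complementary element of S which is positive
    at i; their infimum is 0. *)
Lemma coord_ideal_maximal S i : good_semigroup S ->
  maximal_ideal S [set a | S a /\ 0 < a i].
Proof.
move=> [[S0 SD] Spos [c /translate_Sbar_subP cS] S1 S2].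
have S_ge0 a j : S a -> 0 <= a j by move/Spos/SbarP.
split.
- split.
  + exists (fun j => Num.max 1 (c j)); split; last by lia.
    by apply: cS => j; lia.
  + move=> a b [Sa a_gt0] Sb; split; first exact: SD.
    by have := S_ge0 _ i Sb; rewrite addfE; lia.
  + by exists 0 => // a; rewrite translateE subr0 => -[].
  + move=> a b [Sa a_gt0] [Sb b_gt0]; split; first exact: S1.
    by rewrite meet_coord; lia.
  + move=> a b j [Sa a_gt0] [Sb b_gt0] eq_ab.
    have [e [Se lt_e He]] := S2 a b j Sa Sb eq_ab.
    by exists e; split=> //; split=> //; have [] := He i; lia.
- by split=> [a []//|/(_ 0 S0)[_]]; rewrite ltxx.
- move=> E [_ ES _ E1 _] ME [EsubS nSE].
  apply/seteqP; split=> // a Ea; split; first exact: EsubS.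
  rewrite ltNge; apply/negP => a_le0; apply: nSE.
  have a_ge0 j := S_ge0 a j (EsubS _ Ea).
  have ai0 : a i = 0 by apply/eqP; rewrite eq_le a_le0 a_ge0.
  (* e is positive at i and vanishes wherever a does not *)
  have [e [Se lt_e He]] := S2 a 0 i (EsubS _ Ea) S0 ai0.
  suff E0 : E 0 by move=> s Ss; rewrite -(add0r s); apply: ES.
  have -> : 0 = Order.meet a e.
    apply/funext => j; rewrite meet_coord.
    have [] := He j; have := a_ge0 j; rewrite zerofE.
    have [->|/eqP aj0] := eqVneq (a j) 0; first by lia.
    by move=> ? _ /(_ aj0); lia.
  by apply: E1 => //; apply: ME; split=> //; rewrite -ai0.
Qed.

(** Uniqueness of the maximal ideal identifies all the ideals of elements that
    are positive at a given coordinate, so a nonzero element of S is positive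
    everywhere. An empty I is excluded because then S = {0} has no proper
    ideal. *)
Lemma local_maximal_ideal S M :
    good_semigroup S -> local_semigroup S -> maximal_ideal S M ->
  [/\ exists i : I, True,
      forall a, M a <-> S a /\ a <> 0
    & forall a i, M a -> 0 < a i].
Proof.
move=> gS [M0 [_ M0_uniq]] maxM.
have MP i : M = [set a | S a /\ 0 < a i].
  by rewrite -(M0_uniq _ maxM); apply: M0_uniq; apply: coord_ideal_maximal.
have [[S0 _] Spos _ _ _] := gS.
have inh : exists i : I, True.
  have [[[a Ma] _ _ _ _] [MS nSM] _] := maxM.
  apply: contrapT => noI; apply: nSM => b _.
  by have <- // : a = b; apply/funext => i; case: noI; exists i.
have Mpos a i : M a -> 0 < a i by rewrite (MP i) => -[].
split=> // a; split=> [Ma|[Sa a_neq0]].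
  have [i _] := inh; split; first by move: Ma; rewrite (MP i) => -[].
  by move=> a0; have := Mpos a i Ma; rewrite a0 ltxx.
have [i ai] : exists i, 0 < a i.
  apply: contrapT => a_npos; apply: a_neq0; apply/funext => i.
  have /SbarP/(_ i) := Spos _ Sa.
  rewrite le_eqVlt => /orP[/eqP <- //|ai].
  by case: a_npos; exists i.
by rewrite (MP i).
Qed.

End Locality.

(** * The semigroup M - M of a symmetric local semigroup *)

Section EndomorphismSemigroup.
Variable I : finType.
Implicit Types (S M E : set (I -> int)) (a b c : I -> int) (i j : I).

Lemma symmetricP S a : symmetric_semigroup S ->
  S a <-> DeltaS S (tau S - a) = set0.
Proof. by case=> _ eqS; rewrite {1}eqS. Qed.

(** For b in E, symmetry says that a + b is in S exactly when b + S avoids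
    Delta(tau - a). The sets b + S cover E, as S contains 0, and stay inside E, so
    together these conditions say that E avoids Delta(tau - a). *)
Lemma colon_symmetric S E : symmetric_semigroup S ->
  (forall a b, E a -> S b -> E (a + b)) ->
  colon S E = [set a | DeltaS E (tau S - a) = set0].
Proof.
move=> symS ES; apply/seteqP; split=> a /=.
- move=> aES; apply/DeltaS0P => i b Eb bi bj.
  have /aES/(symmetricP _ symS)/DeltaS0P noD : translate a E (a + b).
    by rewrite translateE addrC addKr.
  have [[[S0 _] _ _ _ _] _] := symS.
  apply: (noD i 0) => // [|j ij].
    by rewrite !coordE bi !coordE; lia.
  have := bj j ij.
  by rewrite !coordE; lia.
- move=> /DeltaS0P noD b; rewrite translateE => Eba.
  apply/(symmetricP _ symS)/DeltaS0P => i s Ss si sj.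
  apply: (noD i (b - a + s)); first exact: ES.
    by rewrite addfE si !coordE; lia.
  by move=> j ij; have := sj j ij; rewrite !coordE; lia.
Qed.

Variables S M : set (I -> int).
Hypothesis symS : symmetric_semigroup S.
Hypothesis MP : forall a, M a <-> S a /\ a <> 0.
Hypothesis M_gt0 : forall a i, M a -> 0 < a i.

Let goodS : good_semigroup S := proj1 symS.

Lemma max_ideal_closed a b : M a -> S b -> M (a + b).
Proof.
move=> Ma Sb; have [[_ SD] Spos _ _ _] := goodS.
have [Sa a_neq0] := (MP a).1 Ma.
apply/MP; split=> [|ab0]; first exact: SD.
apply: a_neq0; apply/funext => i.
have := M_gt0 i Ma; have /SbarP/(_ i) := Spos _ Sb.
by have := congr1 (@^~ i) ab0; rewrite addfE /=; lia.
Qed.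

Lemma max_ideal_nonempty (i : I) : exists a, M a.
Proof.
have [_ _ [c /translate_Sbar_subP cS] _ _] := goodS.
exists (fun j => Num.max 1 (c j)); apply/MP; split.
  by apply: cS => j; lia.
by move=> /(congr1 (@^~ i)); rewrite /=; lia.
Qed.

(** M - M consists of the nonnegative elements of S - M. Elements of M - M are
    nonnegative because M is bounded below in each coordinate; conversely, for
    a >= 0 no element of a + M can be 0, the only point of S outside M. *)
Lemma end_max_idealP a :
  colon M M a <-> (forall i, 0 <= a i) /\ DeltaS M (tau S - a) = set0.
Proof.
have colonSM : colon S M = _ := colon_symmetric symS max_ideal_closed.
split=> [aMM|[a_ge0 noD]].
  split; last first.
    have: colon S M a by move=> b /aMM/MP[].
    by rewrite colonSM.
  (* translate an element of M whose i-th coordinate is least *)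
  move=> i; have [m0 Mm0] := max_ideal_nonempty i.
  pose coord n := `[< exists m, M m /\ m i = n%:Z >].
  have ex_coord : exists n, coord n.
    exists (absz (m0 i)); apply/asboolP; exists m0; split=> //.
    by have := M_gt0 i Mm0; lia.
  case: (ex_minnP ex_coord) => n /asboolP[m [Mm mi]] min_n.
  have /aMM Mam : translate a M (a + m) by rewrite translateE addrC addKr.
  have := min_n (absz ((a + m) i)).
  have -> : coord (absz ((a + m) i)).
    by apply/asboolP; exists (a + m); split=> //; have := M_gt0 i Mam; lia.
  by move/(_ isT); have := M_gt0 i Mam; rewrite addfE; lia.
have aS : colon S M a by rewrite colonSM.
move=> b ab; apply/MP; split; first exact: aS.
move: ab; rewrite translateE => Mba b0.
have [[i _]|noI] := pselect (exists i : I, True).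
  have := M_gt0 i Mba; have := a_ge0 i.
  by have := congr1 (@^~ i) b0; rewrite /= !coordE; lia.
have /MP[_ nz] := Mba; case: nz.
by apply/funext => i; case: noI; exists i.
Qed.

Lemma sub_end_max_ideal : S `<=` colon M M.
Proof.
move=> s Ss b; rewrite translateE => Mbs.
by rewrite -(subrK s b); apply: max_ideal_closed.
Qed.

(** If Delta^M(tau - a) is empty but Delta^S(tau - a) is not, then 0 is what
    lies in the latter, and this puts a in Delta(tau). *)
Lemma end_max_ideal_cases a : colon M M a -> S a \/ Delta (tau S) a.
Proof.
move=> /end_max_idealP[a_ge0 /DeltaS0P noD].
have [Sa|nSa] := pselect (S a); [by left|right].
apply: contrapT => nDa; apply: nSa.
apply/(symmetricP _ symS)/DeltaS0P => i b Sb bi bj.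
have [b0|nb0] := pselect (b = 0); last first.
  by apply: (noD i b) => //; apply/MP.
apply: nDa; exists i => //; split.
  by have := bi; rewrite b0 !coordE; lia.
by move=> j ij; have := bj j ij; rewrite b0 !coordE; lia.
Qed.

Lemma end_max_ideal_above a :
  (forall i, 0 <= a i) -> (forall i, tau S i <= a i) -> colon M M a.
Proof.
move=> a_ge0 le_a; apply/end_max_idealP; split=> //.
apply/DeltaS0P => i b Mb + _; rewrite !coordE.
by have := M_gt0 i Mb; have := le_a i; lia.
Qed.

(** A point of M that obstructs the raised point cannot do so at j, where it
    would have to be negative; at any other coordinate it already obstructs
    a, since being positive it exceeds tau - a at j. *)
Lemma end_max_ideal_raise a j : colon M M a -> tau S j <= a j ->
  colon M M (fun k => a k + (k == j)%:R).
Proof.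
move=> /end_max_idealP[a_ge0 /DeltaS0P noD] le_aj; apply/end_max_idealP.
split=> [k|]; first by have := a_ge0 k; lia.
apply/DeltaS0P => i b Mb; rewrite !coordE => bi bj.
have ij : (i == j) = false.
  by apply/eqP => eij; have := M_gt0 i Mb; rewrite bi; subst i; lia.
apply: (noD i b) => // [|k ki]; first by rewrite !coordE bi ij addr0.
have := bj k ki; rewrite !coordE; have [->|_] := eqVneq k j; last by lia.
by have := M_gt0 j Mb; lia.
Qed.

Lemma end_max_ideal_good : good_semigroup (colon M M).
Proof.
have [[S0 SD] Spos [c cS] S1 S2] := goodS.
have TP := end_max_idealP.
have M1 : E1 M.
  move=> a b Ma Mb; apply/MP; split.
    by apply: S1; [case/MP: Ma|case/MP: Mb].
  have [_ a_neq0] := (MP a).1 Ma.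
  move=> m0; apply: a_neq0; apply/funext => i.
  have := congr1 (@^~ i) m0; rewrite /= meet_coord zerofE.
  by have := M_gt0 i Ma; have := M_gt0 i Mb; lia.
have T1 : E1 (colon M M).
  move=> a b Ta Tb x; rewrite translateE => Mx.
  pose y := x - Order.meet a b.
  have -> : x = Order.meet (a + y) (b + y).
    by apply/funext => i; rewrite /y !(meet_coord, coordE); lia.
  by apply: M1; [apply: Ta|apply: Tb]; rewrite translateE addrC addKr.
split=> //.
- split=> [x|a b Ta Tb x]; first by rewrite translateE subr0.
  rewrite translateE => Mx; apply: Ta; rewrite translateE.
  apply: Tb; rewrite translateE.
  by move: Mx; rewrite opprD addrA.
- by move=> a /TP[a_ge0 _]; apply/SbarP.
- by exists c; apply: subset_trans sub_end_max_ideal.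
- move=> a b j Ta Tb eq_ab.
  (* Points of Delta(tau) lie above tau, so both points are in S when their
     common j-th coordinate is below tau_j; otherwise raise the infimum at j. *)
  have [lt_aj|le_aj] := ltP (a j) (tau S j).
    have inS x : colon M M x -> x j < tau S j -> S x.
      case/end_max_ideal_cases => // -[i _ [xi xj]] lt_xj.
      have := xj j; have [eij|_] := eqVneq j i; first by subst j; lia.
      by move/(_ isT); lia.
    have [||e [Se lt_e He]] := S2 a b j _ _ eq_ab; try by apply: inS => //; lia.
    by exists e; split=> //; apply: sub_end_max_ideal.
  exists (fun k => Order.meet a b k + (k == j)%:R); split.
  + by apply: end_max_ideal_raise; [exact: T1|rewrite meet_coord; lia].
  + by rewrite meet_coord eqxx; lia.
  + move=> i; rewrite meet_coord; split; first by lia.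
    by have [->|_] := eqVneq i j; [lia|rewrite addr0].
Qed.

End EndomorphismSemigroup.

(** * The monoids generated by 1, and by 2 and an odd number *)

Section Generators.
Variable I : finType.
Implicit Types (S : set (I -> int)) (a : I -> int).

Lemma submonoid_scale S a (k : nat) :
  submonoid S -> S a -> S (fun i => k%:Z * a i).
Proof.
move=> [S0 SD] Sa; elim: k => [|k IHk].
  by rewrite (_ : (fun i => _) = 0) //; apply/funext => i; rewrite mul0r.
rewrite (_ : (fun i => _) = a + (fun i => k%:Z * a i)); first exact: SD.
by apply/funext => i; rewrite addfE intS mulrDl mul1r.
Qed.

Lemma submonoid_diag S (k : nat) : submonoid S -> S 1 -> S (cst k%:Z).
Proof.
move=> submonS S1; rewrite (_ : cst _ = fun i => k%:Z * (1 : I -> int) i).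
  exact: submonoid_scale.
by apply/funext => i; rewrite /= mulr1.
Qed.

Lemma generated_submonoid (G : set (I -> int)) : submonoid (generated G).
Proof.
split=> [N [[N0 _] _] //|a b Ga Gb N NG].
by have [[_ ND] _] := NG; apply: ND; [apply: Ga|apply: Gb].
Qed.

Lemma generated_one a : generated [set 1] a <-> exists k : nat, a = cst k%:Z.
Proof.
split=> [|[k ->]]; last first.
  apply: (submonoid_diag k (generated_submonoid _)).
  exact: sub_gen_smallest.
pose N : set (I -> int) := [set a | exists k : nat, a = cst k%:Z].
apply: (@smallest_sub _ _ _ N) => [|_ ->]; last by exists 1%N.
split=> [|_ _ [k ->] [l ->]]; first by exists 0%N.
by exists (k + l)%N; apply/funext => i.
Qed.

Lemma generated_two_odd (n : nat) a : ~~ odd n ->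
  generated [set cst 2%:Z; cst n.+1%:Z] a <->
  exists k : nat, a = cst k.*2%:Z \/ a = cst (n.+1 + k.*2)%:Z.
Proof.
move=> n_even; set G := [set _; _].
split.
  pose N : set (I -> int) :=
    [set a | exists k : nat, a = cst k.*2%:Z \/ a = cst (n.+1 + k.*2)%:Z].
  apply: (@smallest_sub _ _ _ N) => [|_ [|] ->]; last 2 first.
  - by exists 1%N; left.
  - by exists 0%N; right; rewrite addn0.
  have cstD (x y : nat) : (cst x%:Z + cst y%:Z : I -> int) = cst (x + y)%:Z.
    by [].
  split=> [|_ _ [k [->|->]] [l [->|->]]]; rewrite ?cstD.
  + by exists 0%N; left.
  + by exists (k + l)%N; left; rewrite doubleD.
  + by exists (k + l)%N; right; congr (cst _%:Z); lia.
  + by exists (k + l)%N; right; congr (cst _%:Z); lia.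
  + by exists (n.+1 + k + l)%N; left; congr (cst _%:Z); lia.
have scaleG (k : nat) : generated G (cst k.*2%:Z).
  rewrite (_ : cst _ = fun i : I => k%:Z * (cst 2%:Z : I -> int) i).
    apply: (submonoid_scale k (generated_submonoid G)).
    by apply: sub_gen_smallest; left.
  by apply/funext => i; rewrite /= -muln2 PoszM.
case=> k [->|->]; first exact: scaleG.
have [_ GD] := generated_submonoid G.
rewrite (_ : cst _ = (cst n.+1%:Z : I -> int) + cst k.*2%:Z) //.
by apply: GD; [apply: sub_gen_smallest; right|].
Qed.

End Generators.

(** * Classification when S and M - M are symmetric *)

Section BothSymmetric.
Variable I : finType.
Implicit Types (a b c : I -> int) (i j : I).

Variables S M : set (I -> int).
Hypothesis symS : symmetric_semigroup S.
Hypothesis MP : forall a, M a <-> S a /\ a <> 0.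
Hypothesis M_gt0 : forall a i, M a -> 0 < a i.
Hypothesis symT : symmetric_semigroup (colon M M).
Hypothesis tau_ge0 : forall i, 0 <= tau S i.

Let d := tau S - tau (colon M M).
Let goodS : good_semigroup S := proj1 symS.

(** Both sides say that M - M avoids Delta(tau S - a): the right-hand side by
    symmetry of M - M, the left-hand side because M is the dual of M - M with
    respect to S. *)
Lemma max_ideal_translate (i0 : I) a : M a <-> colon M M (a - d).
Proof.
have -> : colon M M (a - d) <-> DeltaS (colon M M) (tau S - a) = set0.
  rewrite (symmetricP _ symT).
  suff -> : tau (colon M M) - (a - d) = tau S - a by [].
  by apply/funext => i; rewrite /d !coordE; lia.
split=> [/MP[Sa a_neq0]|noD].
  have a_gt0 i : 0 < a i by apply/M_gt0/MP.
  apply/DeltaS0P => i b /(end_max_ideal_cases symS MP M_gt0)[Sb|].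
    by have /(symmetricP _ symS)/DeltaS0P noD := Sa; apply: noD.
  case=> k _ [bk bj]; rewrite coordE => bi _.
  have := a_gt0 i; have := bj i; move: bk bi; rewrite coordE.
  by have [->|_] := eqVneq i k; [lia|move=> ? ? /(_ isT); lia].
have noDS := (DeltaS0P _ _).1 noD.
apply/MP; split=> [|a0].
  apply/(symmetricP _ symS)/DeltaS0P => i b Sb; apply: noDS.
  exact: sub_end_max_ideal Sb.
(* For a = 0 the set Delta(tau) itself, contained in M - M, is an obstruction *)
have tauT : colon M M (fun j => tau S j + (j != i0)%:R).
  apply: (end_max_ideal_above symS MP M_gt0) => i; last by lia.
  by have := tau_ge0 i; lia.
apply: (noDS i0 _ tauT); first by rewrite a0 subr0 eqxx addr0.
by move=> j ->; rewrite a0 subr0; lia.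
Qed.

Lemma step_gt0 i : 0 < d i.
Proof.
have [[[T0 _] _ _ _ _] _] := symT.
by apply: (@M_gt0 d i); apply/(max_ideal_translate i); rewrite subrr.
Qed.

(** Descent along M = d + (M - M), where M - M is the union of S and Delta(tau):
    subtract d until reaching 0 or a point of Delta(tau). The coordinate i0
    measures progress. *)
Lemma both_symmetric_cases (i0 : I) a : S a ->
  exists k : nat, (forall i, a i = k%:Z * d i) \/
    [/\ (0 < k)%N & exists i, a i = tau S i + k%:Z * d i
      /\ forall j, j != i -> tau S j + k%:Z * d j < a j].
Proof.
have [_ Spos _ _ _] := goodS.
have [n] := ubnP (absz (a i0)); elim: n a => // n IHn a le_an Sa.
have [->|a_neq0] := pselect (a = 0).
  by exists 0%N; left=> i; rewrite mul0r.
have Ma : M a by apply/MP.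
have a_gt0 := M_gt0 i0 Ma; have d_gt0 := step_gt0 i0.
have kS (k : nat) i : k.+1%:Z * d i = k%:Z * d i + d i.
  by rewrite intS mulrDl mul1r addrC.
have /(max_ideal_translate i0)/(end_max_ideal_cases symS MP M_gt0)[Sad|] := Ma.
  have /SbarP/(_ i0) := Spos _ Sad; rewrite !coordE => ad_ge0.
  have [|k [kd|[k_gt0 [i [ai aj]]]]] := IHn _ _ Sad.
  - by rewrite !coordE; lia.
  - by exists k.+1; left=> i; have := kd i; rewrite kS !coordE; lia.
  - exists k.+1; right; split=> //; exists i; split.
      by have := ai; rewrite kS !coordE; lia.
    by move=> j ij; have := aj j ij; rewrite kS !coordE; lia.
case=> i _ [ai aj]; exists 1%N; right; split=> //; exists i; split.
  by have := ai; rewrite !coordE; lia.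
by move=> j ij; have := aj j ij; rewrite !coordE; lia.
Qed.

Lemma above_tau a : (forall i, tau S i < a i) -> S a.
Proof.
have [S_above _] := conductorP goodS.
move=> lt_a; apply: S_above => i; have := lt_a i; rewrite tauE; lia.
Qed.

(** Take two points of S that agree with the conductor at i and are adjacent at
    j. They are not both multiples of d, as d is positive at i. One that is not
    lies in some k d + Delta(tau), and minimality at i leaves only k d_i = 1. *)
Lemma step_eq1 i j : j != i -> d i = 1.
Proof.
move=> ij; have di_gt0 := step_gt0 i; have dj_gt0 := step_gt0 j.
pose p (x : nat) k : int := tau S k + 1 + ((k != i) * x)%:Z.
have pi x : p x i = tau S i + 1 by rewrite /p eqxx addr0.
have pj x : p x j = tau S j + 1 + x%:Z by rewrite /p ij mul1n.
have pS x : S (p x) by apply: above_tau => k; rewrite /p; lia.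
have pP x : (exists k : nat, forall l, p x l = k%:Z * d l) \/ d i = 1.
  have [k [kd|[k_gt0 [l [pl plt]]]]] := both_symmetric_cases i (pS x).
    by left; exists k.
  (* membership in k d + Delta_l(tau) with l distinct from i would make p exceed
     the conductor at i *)
  right; have := plt i; move: pl; rewrite eq_sym.
  have [->|li] := eqVneq l i; first by rewrite pi; nia.
  by move=> _ /(_ isT); rewrite pi; nia.
have [[k0 k0d]|//] := pP 0%N; have [[k1 k1d]|//] := pP 1%N.
have kk : k0%:Z = k1%:Z.
  by apply: (mulIf (lt0r_neq0 di_gt0)); rewrite -k0d -k1d !pi.
by have := k1d j; rewrite -kk -k0d !pj; lia.
Qed.

(** If |I| = 1, every integer beyond tau is a multiple of d or congruent to tau
    modulo d. Two of any three consecutive ones are therefore congruent modulo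
    d, whence d <= 2; and d = 1 is impossible because tau is not in S. *)
Lemma both_symmetric_rank1 (i0 : I) : (forall i, i = i0) ->
  exists n : nat, [/\ ~~ odd n, #|I| = 1%N
    & S = generated [set cst 2%:Z; cst n.+1%:Z]].
Proof.
move=> allI; have d_gt0 := step_gt0 i0; have t_ge0 := tau_ge0 i0.
have cstE a x : a i0 = x -> a = cst x.
  by move=> ax; apply/funext => i; rewrite (allI i).
have [[S0 SD] Spos _ _ _] := goodS.
have notSt : ~ S (tau S).
  move=> /(symmetricP _ symS)/DeltaS0P/(_ i0 0 S0)[]; first by rewrite subrr.
  by move=> j; rewrite (allI j) eqxx.
have cases x : tau S i0 < x -> exists k : nat,
    x = k%:Z * d i0 \/ x = tau S i0 + k%:Z * d i0.
  move=> lt_x; have Sx : S (cst x) by apply: above_tau => i; rewrite (allI i).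
  have [k [kd|[_ [i [ki _]]]]] := both_symmetric_cases i0 Sx; exists k.
    by left; exact: kd.
  by right; move: ki; rewrite (allI i).
have Sd : S d.
  have Md : M d.
    apply/(max_ideal_translate i0); rewrite subrr.
    by have [[[]]] := symT.
  by case/MP: Md.
have Skd (k : nat) : S (cst (k%:Z * d i0)).
  rewrite (_ : cst _ = fun i => k%:Z * d i).
    by apply: submonoid_scale.
  by apply/funext => i; rewrite (allI i).
have d2 : d i0 = 2.
  have d_neq1 : d i0 <> 1.
    move=> d1; apply: notSt; have := Skd (absz (tau S i0)).
    by rewrite d1 mulr1 gez0_abs // -(cstE (tau S)).
  have [|k0 H0] := cases (tau S i0 + 1); first by lia.
  have [|k1 H1] := cases (tau S i0 + 2); first by lia.
  have [|k2 H2] := cases (tau S i0 + 3); first by lia.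
  have diff (k l : nat) (e : int) : 0 < e -> e <= 2 ->
      k%:Z * d i0 - l%:Z * d i0 = e -> d i0 = 2.
    move=> e_gt0 e_le2; rewrite -mulrBl; set q := _ - _ => qd.
    have q_gt0 : 0 < q by rewrite -(pmulr_lgt0 _ d_gt0) qd.
    have [q1|q_gt1] : q = 1 \/ 1 < q by lia.
      by move: qd; rewrite q1; lia.
    have : 2 * 2 <= q * d i0 by apply: ler_pM; lia.
    by lia.
  have [H0'|H0'] := H0; have [H1'|H1'] := H1; have [H2'|H2'] := H2;
    first [ by apply: (diff k1 k0 1); lia
          | by apply: (diff k2 k1 1); lia
          | by apply: (diff k2 k0 2); lia ].
exists (absz (tau S i0 + 1)).
have n_even : ~~ odd (absz (tau S i0 + 1)).
  apply/negP => odd_t; apply: notSt.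
  have := Skd (absz (tau S i0))./2.
  have -> : (absz (tau S i0))./2%:Z * d i0 = tau S i0 by rewrite d2; lia.
  by rewrite -(cstE (tau S)).
split=> //.
  by rewrite -(card1 i0); apply: eq_card => i; rewrite !inE (allI i) eqxx.
apply/seteqP; split=> [a Sa|]; last first.
  apply: smallest_sub => [|_ [->|->]] /=.
  - by split.
  - by have := Skd 1%N; rewrite d2.
  - by apply: above_tau => i; rewrite (allI i) /cst; lia.
apply/(generated_two_odd _ n_even).
have [k [kd|[k_gt0 [i [ki _]]]]] := both_symmetric_cases i0 Sa.
  by exists k; left; apply: cstE; rewrite kd d2; lia.
exists k.-1; right; apply: cstE; move: ki; rewrite (allI i) d2 => ->.
by lia.
Qed.

(** Here d = 1. With a third coordinate k, a point that agrees with the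
    conductor outside k agrees with it in two coordinates, which no point of
    h d + Delta(tau) does for h >= 1; so it would be constant, and remain so
    after being raised at k. With two coordinates the conductor is itself in S
    and, for the same reason, constant. *)
Lemma both_symmetric_rank2 (i0 i1 : I) : i0 != i1 ->
  exists n : nat, [/\ odd n, #|I| = 2%N
    & S = generated [set 1] `|` translate (cst (n.+1)./2%:Z) Sbar].
Proof.
move=> i01.
have other i : exists j, j != i.
  have [->|] := eqVneq i i0; first by exists i1; rewrite eq_sym.
  by exists i0; rewrite eq_sym.
have d1 i : d i = 1 by have [j /step_eq1] := other i.
have allI k : k = i0 \/ k = i1.
  apply: contrapT => /not_orP[/eqP k0 /eqP k1].
  pose p (x : nat) l : int := tau S l + 1 + ((l == k) * x)%:Z.
  have pS x : S (p x) by apply: above_tau => l; rewrite /p; lia.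
  have pP x : exists m : nat, forall l, p x l = m%:Z.
    have [m [md|[m_gt0 [l [pl plt]]]]] := both_symmetric_cases i0 (pS x).
      by exists m => l; rewrite md d1 mulr1.
    exfalso; move: pl; rewrite d1 mulr1 /p => pl.
    have [li0|li0] := eqVneq i0 l.
      have i1l : i1 != l by rewrite -li0 eq_sym.
      have := plt i1 i1l; rewrite d1 mulr1 /p.
      by rewrite (negbTE (_ : i1 != k)) 1?eq_sym //; lia.
    have := plt i0 li0; rewrite d1 mulr1 /p.
    by rewrite (negbTE (_ : i0 != k)) 1?eq_sym //; lia.
  have [m0 Hm0] := pP 0%N; have [m1 Hm1] := pP 1%N.
  have := Hm0 i0; have := Hm1 i0; have := Hm0 k; have := Hm1 k.
  rewrite /p eqxx [i0 == k]eq_sym (negbTE k0) !mul0n.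
  by lia.
have [k Hk] : exists k : nat, forall i, tau S i + 1 = k%:Z.
  have St : S (fun i => tau S i + 1) by apply: above_tau => i; lia.
  have [k [kd|[k_gt0 [l [tl tlt]]]]] := both_symmetric_cases i0 St.
    by exists k => i; rewrite kd d1 mulr1.
  by have [j lj] := other l; have := tlt j lj; move: tl; rewrite !d1; lia.
have k_gt0 : (0 < k)%N by have := Hk i0; have := tau_ge0 i0; lia.
exists k.*2.-1; have -> : k.*2.-1.+1./2 = k by lia.
split; first by lia.
  have <- : #|pred2 i0 i1| = 2%N by rewrite card2 i01.
  apply: eq_card => i; rewrite !inE.
  by case: (allI i) => ->; rewrite eqxx ?orbT.
have [submonS Spos _ _ _] := goodS.
apply/seteqP; split=> [a Sa|a [|]].
- have [m [md|[m_gt0 [l [al alt]]]]] := both_symmetric_cases i0 Sa.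
    left; apply/generated_one; exists m.
    by apply/funext => i; rewrite md d1 mulr1.
  right; rewrite translateE; apply/SbarP => i; rewrite !coordE /cst.
  have [eil|il] := eqVneq i l.
    by subst l; have := Hk i; move: al; rewrite d1; lia.
  by have := Hk i; have := alt i il; rewrite d1; lia.
- apply: (smallest_sub submonS) => _ ->.
  have : M d.
    apply/(max_ideal_translate i0); rewrite subrr.
    by have [[[]]] := symT.
  rewrite (_ : d = 1); first by case/MP.
  by apply/funext => i; rewrite d1.
- rewrite translateE => /SbarP le_a; apply: above_tau => i.
  by have := le_a i; rewrite !coordE /cst; have := Hk i; lia.
Qed.

End BothSymmetric.

(** The remaining case is a conductor that vanishes somewhere: being in S, it is
    then 0, so that S is all of N^I, which is local only when I is a
    singleton. *)
Lemma both_symmetric_classification (I : finType) (S M : set (I -> int)) :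
    symmetric_semigroup S -> symmetric_semigroup (colon M M) ->
    (exists i : I, True) ->
    (forall a, M a <-> S a /\ a <> 0) -> (forall a i, M a -> 0 < a i) ->
  (exists n : nat, [/\ ~~ odd n, #|I| = 1%N
     & S = generated [set cst 2%:Z; cst n.+1%:Z]])
  \/
  (exists n : nat, [/\ odd n, #|I| = 2%N
     & S = generated [set 1] `|` translate (cst (n.+1)./2%:Z) Sbar]).
Proof.
move=> symS symT [i0 _] MP M_gt0; have [goodS _] := symS.
have [[S0 SD] Spos _ _ _] := goodS.
have [S_above c_ge0] := conductorP goodS.
have [tau_ge0|/existsNP[i /negP]] := pselect (forall i, 0 <= tau S i).
  have [allI|/existsNP[i1 /eqP]] := pselect (forall i, i = i0).
    left; exact: (both_symmetric_rank1 symS MP M_gt0 symT tau_ge0 allI).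
  rewrite eq_sym => i01.
  right; exact: (both_symmetric_rank2 symS MP M_gt0 symT tau_ge0 i01).
rewrite -ltNge tauE => ti_lt0.
have ci0 : conductor S i = 0.
  by have := c_ge0 i; move: ti_lt0; lia.
have c0 : conductor S = 0.
  apply: contrapT => c_neq0.
  have : M (conductor S) by apply/MP; split=> //; apply: S_above.
  by move/(M_gt0 _ i); rewrite ci0.
have S_full a : (forall j, 0 <= a j) -> S a.
  by move=> a_ge0; apply: S_above; rewrite c0.
have allI j : j = i.
  apply: contrapT => /eqP ji.
  have : M (fun k => (k != i)%:R).
    apply/MP; split; first by apply: S_full => k; lia.
    by move/(congr1 (@^~ j)); rewrite /= ji.
  by move/(M_gt0 _ i); rewrite eqxx.
left; exists 0%N; split=> //.
  by rewrite -(card1 i); apply: eq_card => j; rewrite !inE (allI j) eqxx.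
apply/seteqP; split=> [a /Spos/SbarP a_ge0|].
  apply/generated_two_odd => //.
  exists (absz (a i))./2; have [odd_a|even_a] := boolP (odd (absz (a i))).
    right; apply/funext => j; rewrite (allI j) /cst.
    by have := a_ge0 i; lia.
  left; apply/funext => j; rewrite (allI j) /cst.
  by have := a_ge0 i; lia.
by apply: smallest_sub => [|_ [->|->]] //; apply: S_full.
Qed.

(** * Symmetry of the semigroups containing a semigroup of the list *)

Section Oversemigroups.
Variable I : finType.
Implicit Types (S : set (I -> int)) (a b e : I -> int) (i j : I).

(** For its least odd element m, the semigroup consists of the even numbers
    x >= 0 and the odd numbers x >= m. So its conductor is m - 1, and the
    reflection x |-> m - 2 - x exchanges it with its complement. *)
Lemma symmetric_over_two_odd S n : good_semigroup S -> ~~ odd n ->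
  #|I| = 1%N -> S (cst 2%:Z) -> S (cst n.+1%:Z) -> symmetric_semigroup S.
Proof.
move=> goodS n_even cardI S2 Sn; have [[S0 SD] Spos _ _ _] := goodS.
have [i0 allI] : exists i0 : I, forall i, i = i0.
  by have [i0 eqI] := fintype1 cardI; exists i0.
have cstE a : a = cst (a i0) by apply/funext => i; rewrite (allI i).
pose P m := odd m && `[< S (cst m%:Z) >].
have exP : exists m, P m by exists n.+1; rewrite /P /= n_even; apply/asboolP.
case: (ex_minnP exP) => m /andP[odd_m /asboolP Sm] min_m.
have S_even (k : nat) : S (cst k.*2%:Z).
  rewrite (_ : cst _ = fun i => k%:Z * (cst 2%:Z : I -> int) i).
    exact: submonoid_scale.
  by apply/funext => i; rewrite /= -muln2 PoszM.
have SP x : S (cst x) <-> 0 <= x /\ (~~ odd (absz x) \/ m%:Z <= x).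
  split=> [Sx|[x_ge0 x_in]].
    have x_ge0 : 0 <= x by have /SbarP/(_ i0) := Spos _ Sx.
    split=> //; have [odd_x|] := boolP (odd (absz x)); [right|by left].
    suff : (m <= absz x)%N by lia.
    by apply: min_m; rewrite /P odd_x; apply/asboolP; rewrite gez0_abs.
  have [odd_x|even_x] := boolP (odd (absz x)).
    have {x_in}le_mx : m%:Z <= x by case: x_in => // /negP.
    rewrite (_ : cst x = (cst m%:Z : I -> int) + cst ((absz x - m)./2.*2)%:Z).
      exact: SD.
    by apply/funext => i; rewrite addfE /cst; lia.
  rewrite (_ : cst x = cst ((absz x)./2.*2)%:Z) //.
  by apply/funext => i; rewrite /cst; lia.
have condS : conductor S = cst (m%:Z - 1).
  apply: conductor_unique => [b le_b|a aS i].
    rewrite (cstE b); apply/SP; have := le_b i0; rewrite /cst.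
    split; first by lia.
    by have [odd_b|] := boolP (odd (absz (b i0))); [right; lia|left].
  rewrite /cst leNgt; apply/negP => lt_ai.
  have /SP : S (cst (m%:Z - 2)).
    by apply: aS => j; move: lt_ai; rewrite (allI i) (allI j) /cst; lia.
  by lia.
split=> //; apply/seteqP.
have tau_S : tau S i0 = m%:Z - 2 by rewrite tauE condS /cst; lia.
have DP a : DeltaS S (tau S - a) = set0 <-> ~ S (cst (m%:Z - 2 - a i0)).
  split=> [/DeltaS0P noD Sx|nS].
    apply: (noD i0 _ Sx); first by rewrite !coordE tau_S.
    by move=> j; rewrite (allI j) eqxx.
  apply/DeltaS0P => i b Sb; rewrite (allI i) !coordE tau_S => bi _.
  by apply: nS; rewrite -bi -cstE.
split=> a /=.
  by rewrite {1}(cstE a) => /SP Sa; apply/DP => /SP; lia.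
move=> /DP nS; rewrite (cstE a); apply/SP; move: nS.
by move=> /(contra_not (SP _).2); lia.
Qed.

(** Comparing, by (E2) at j, a point above the diagonal with the diagonal point
    of the same j-th coordinate raises it at j and keeps its i-th coordinate.
    Repeating this, and cutting down by infima with diagonal points, reaches
    every point above the diagonal with that i-th coordinate. *)
Lemma spread_above S i j a b : good_semigroup S -> S 1 ->
    (forall k, k = i \/ k = j) -> S a -> a i < a j ->
  b i = a i -> b i <= b j -> S b.
Proof.
move=> [submonS Spos _ S1 S2] S_1 allI Sa lt_a eq_b le_b.
have S_diag x : 0 <= x -> S (cst x).
  by move=> x_ge0; rewrite -(gez0_abs x_ge0); apply: submonoid_diag.
have S_ge0 e k : S e -> 0 <= e k by move=> /Spos/SbarP.
have tall (n : nat) : exists e, [/\ S e, e i = a i & a j + n%:Z <= e j].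
  elim: n => [|n [e [Se ei ej]]]; first by exists a; rewrite addr0.
  have Sd : S (cst (e j)) by apply: S_diag; apply: S_ge0.
  have [f [Sf lt_f Hf]] := S2 e (cst (e j)) j Se Sd erefl.
  exists f; split=> //; last by lia.
  have [_ ->] := Hf i; first by rewrite /cst; lia.
  by rewrite /cst; lia.
have [e [Se ei ej]] := tall (absz (b j)).
have bj_ge0 : 0 <= b j by have := S_ge0 a i Sa; lia.
rewrite (_ : b = Order.meet e (cst (b j))).
  by apply: S1 => //; apply: S_diag.
apply/funext => k; rewrite meet_coord /cst.
have aj_ge0 := S_ge0 a j Sa.
by case: (allI k) => ->; lia.
Qed.

(** Let m be least with (m, m) + N^2 inside S. A point of S off the diagonal
    with smaller coordinate p spreads to all of (p, p) + N^2, so p >= m; hence S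
    is the diagonal together with (m, m) + N^2, with conductor (m, m). *)
Lemma symmetric_over_diagonal S c : good_semigroup S -> S 1 ->
  #|I| = 2%N -> translate (cst c) Sbar `<=` S -> symmetric_semigroup S.
Proof.
move=> goodS S_1 cardI /translate_Sbar_subP cS.
have [submonS Spos _ _ S2] := goodS.
have S_ge0 a k : S a -> 0 <= a k by move=> /Spos/SbarP.
have S_diag x : 0 <= x -> S (cst x).
  by move=> x_ge0; rewrite -(gez0_abs x_ge0); apply: submonoid_diag.
have other i : exists2 j, j != i & forall k, k = i \/ k = j.
  have : #|predC1 i| = 1%N by have := cardC1 i; rewrite cardI.
  move=> /mem_card1[j predj]; exists j.
    by have := predj j; rewrite !inE eqxx.
  move=> k; have := predj k; rewrite !inE.
  by case: eqP => [|_ /esym/eqP]; [left|right].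
pose P m := `[< forall b, (forall i, m%:Z <= b i) -> S b >].
have exP : exists m, P m.
  exists (absz c); apply/asboolP => b le_b; apply: cS => i.
  by have := le_b i; rewrite /cst; lia.
case: (ex_minnP exP) => m /asboolP mS min_m {c cS exP}.
have cases a : S a -> (forall i j, a i = a j) \/ forall i, m%:Z <= a i.
  move=> Sa; have [|/existsNP[i /existsNP[j aij]]] :=
    pselect (forall i j, a i = a j); first by left.
  right; have {i j aij}[i [j [ij allij lt_a]]] : exists i j,
      [/\ j != i, forall k, k = i \/ k = j & a i < a j].
    have ij : j != i by apply: contra_notN aij => /eqP ->.
    have allij k : k = i \/ k = j.
      have [j' j'i allk] := other i.
      by have [ji|->] := allk j; [rewrite ji eqxx in ij|].
    have [lt_a|lt_a|//] := ltgtP (a i) (a j); first by exists i, j.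
    exists j, i; split=> //; first by rewrite eq_sym.
    by move=> k; case: (allij k) => ->; [right|left].
  suff : P (absz (a i)).
    move/min_m => le_m k; have := S_ge0 a i Sa.
    by case: (allij k) => ->; lia.
  have allji k : k = j \/ k = i by case: (allij k) => ->; [right|left].
  have up b : b i = a i -> b i <= b j -> S b.
    exact: (spread_above goodS S_1 allij Sa lt_a).
  (* (E2) at i moves a point above the diagonal to a point below it *)
  have [e [Se lt_e ej]] : exists e, [/\ S e, e j < e i & e j = a i].
    have Sd : S (cst (a i)) by apply: S_diag; apply: S_ge0.
    have [e [Se lt_e He]] := S2 a (cst (a i)) i Sa Sd erefl.
    have [_ ej] := He j; exists e.
    have {}ej : e j = a i by rewrite ej /cst; lia.
    by split=> //; rewrite ej.
  have down b : b j = a i -> b j <= b i -> S b.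
    by rewrite -ej; apply: (spread_above goodS S_1 allji Se lt_e).
  apply/asboolP => b le_b; have := S_ge0 a i Sa => ai_ge0.
  have shift t : 0 <= t -> S (b - cst t) -> S b.
    by move=> t_ge0 /(submonS.2 _ _)/(_ (S_diag _ t_ge0)); rewrite subrK.
  have [le_ij|lt_ji] := leP (b i) (b j).
    apply: (shift (b i - a i)); first by have := le_b i; lia.
    by apply: up; rewrite !coordE /cst; lia.
  apply: (shift (b j - a i)); first by have := le_b j; lia.
  by apply: down; rewrite !coordE /cst; lia.
have condS : conductor S = cst m%:Z.
  apply: conductor_unique => [b|a aS i]; first exact: mS.
  rewrite /cst leNgt; apply/negP => lt_ai; have [j ji _] := other i.
  have := aS (fun k => if k == i then a i else 1 + Num.max (a i) (a k)).
  case/(_ _)/cases => [k|/(_ i j)|/(_ i)].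
  - by case: eqVneq => [->|_]; lia.
  - by rewrite eqxx (negbTE ji); lia.
  - by rewrite eqxx; lia.
have tauS i : tau S i = m%:Z - 1 by rewrite tauE condS.
split=> //; apply/seteqP; split=> a /=.
  move=> Sa; apply/DeltaS0P => i b Sb; have [j ji _] := other i.
  rewrite coordE oppfE tauS => bi /(_ j ji); rewrite coordE oppfE tauS => bj.
  have := cases a Sa => -[/(_ i j)|/(_ i)]; have := S_ge0 a i Sa.
    by have := cases b Sb => -[/(_ i j)|/(_ i)]; lia.
  by have := S_ge0 b i Sb; lia.
move=> /DeltaS0P noD.
have a_ge0 i : 0 <= a i.
  rewrite leNgt; apply/negP => ai_lt0.
  (* at i this point is above the conductor since a i is negative *)
  pose b k : int := if k == i then m%:Z - 1 - a i
                    else Num.max m%:Z (m%:Z - a k).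
  apply: (noD i b).
  - by apply: mS => k; rewrite /b; case: eqP => _; lia.
  - by rewrite /b eqxx !coordE tauS.
  - by move=> k /negbTE ki; rewrite /b ki !coordE tauS; lia.
have [le_ma|/existsNP[i /negP]] := pselect (forall i, m%:Z <= a i).
  exact: mS.
rewrite -ltNge => lt_ai; have [j ji allij] := other i.
(* If a is off the diagonal with smaller coordinate a k < m, then the diagonal
   point m - 1 - a k lies in Delta_k(tau - a). *)
have noDd k l : l != k -> (forall x, x != k -> x = l) -> a k < m%:Z ->
    a l <= a k.
  move=> lk only_l lt_ak; rewrite leNgt; apply/negP => lt_akl.
  apply: (noD k (cst (m%:Z - 1 - a k))); first by apply: S_diag; lia.
    by rewrite !coordE tauS.
  by move=> x /only_l ->; rewrite !coordE tauS /cst; lia.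
have le_aji : a j <= a i.
  by apply: noDd => // x xi; case: (allij x) => // xi'; rewrite xi' eqxx in xi.
have le_aij : a i <= a j.
  apply: noDd; first by rewrite eq_sym.
    by move=> x xj; case: (allij x) => // xj'; rewrite xj' eqxx in xj.
  by lia.
rewrite (_ : a = cst (a i)); first exact: S_diag.
by apply/funext => k; case: (allij k) => ->; rewrite /cst //; lia.
Qed.

End Oversemigroups.

Theorem theorem6p4 (I : finType) (S M : set (I -> int))
    (good_S : good_semigroup S) (local_S : local_semigroup S)
    (max_M : maximal_ideal S M) :
  [<->
    (* (a) *)
    forall S' : set (I -> int), good_semigroup S' ->
      S `<=` S' -> S' `<=` Sbar -> symmetric_semigroup S';
    (* (b) *)
    symmetric_semigroup S /\ symmetric_semigroup (colon M M);
    (* (c) *)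
    (exists n : nat, [/\ ~~ odd n, #|I| = 1%N
       & S = generated [set cst 2%:Z; cst n.+1%:Z]])
    \/
    (exists n : nat, [/\ odd n, #|I| = 2%N
       & S = generated [set 1] `|` translate (cst (n.+1)./2%:Z) Sbar])
  ].
Proof.
have [inh MP M_gt0] := local_maximal_ideal good_S local_S max_M.
tfae.
- move=> all_sym.
  have symS : symmetric_semigroup S.
    by apply: all_sym => //; have [] := good_S.
  have goodT := end_max_ideal_good symS MP M_gt0.
  split=> //; apply: all_sym => //; last by have [] := goodT.
  exact: sub_end_max_ideal symS MP M_gt0.
- move=> [symS symT].
  exact: both_symmetric_classification symS symT inh MP M_gt0.
- case=> -[n [n_par cardI ->]] S' goodS' SS' _.
    apply: (symmetric_over_two_odd goodS' n_par cardI); apply: SS'.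
      by apply: sub_gen_smallest; left.
    by apply: sub_gen_smallest; right.
  apply: (symmetric_over_diagonal goodS' _ cardI (c := (n.+1)./2%:Z)).
    by apply: SS'; left; apply: sub_gen_smallest.
  by apply: subset_trans SS'; right.
Qed.
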